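(* Let $F$ be a free group and let $\pi$ be an arbitrary nonempty set of primes. Then for every finitely generated subgroup $H$ of $F$, the $\pi$-isolator $I_{\pi}(H)$ of $H$ in $F$ is a finitely generated subgroup.
   Context: Let $G$ be a group. For a positive integer $m$, a subgroup $H$ of $G$ is called $m$-isolated if for every $g\in G$ the inclusion $g^{m}\in H$ implies $g\in H$. Let $\pi$ be a nonempty set of primes. A $\pi$-number is a positive integer all of whose prime divisors belong to $\pi$. A subgroup $H$ of $G$ is called $\pi$-isolated if it is $m$-isolated for every $\pi$-number $m$ (equivalently, $p$-isolated for every prime $p\in\pi$). The $\pi$-isolator $I_{\pi}(H)$ of a subgroup $H$ of $G$ is the smallest $\pi$-isolated subgroup of $G$ containing $H$, i.e. the intersection of all $\pi$-isolated subgroups of $G$ containing $H$. The free group $F$ may have arbitrary (finite or infinite) rank. *)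

(* Defs.v *)
From HB Require Import structures.
From mathcomp Require Import all_boot.
From mathcomp Require Import classical_sets cardinality.

Set Implicit Arguments.
Unset Strict Implicit.
Unset Printing Implicit Defensive.

Local Open Scope classical_set_scope.
Local Open Scope group_scope.

Definition is_subgroup (G : groupType) (H : set G) : Prop :=
  group_closed [in H].

Definition generated (G : groupType) (S : set G) : set G :=
  smallest (@is_subgroup G) S.

Definition fg_subgroup (G : groupType) (H : set G) : Prop :=
  is_subgroup H /\ exists2 S : set G, finite_set S & H = generated S.

(* Universal property of the inclusion of B into F. A map from B to G is given *)
(* by a total f : F -> G, of which only the values on B are used (G has an     *)
(* element, so every map from B to G extends to F). A multiplicative function  *)
(* between groups is a group morphism. *)
Definition is_free_basis (F : groupType) (B : set F) : Prop :=
  forall (G : groupType) (f : F -> G),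
    exists phi : {multiplicative F -> G},
      (forall x, B x -> phi x = f x) /\
      (forall psi : {multiplicative F -> G},
         (forall x, B x -> psi x = f x) -> psi =1 phi).

Definition is_free_group (F : groupType) : Prop :=
  exists B : set F, is_free_basis B.

Definition isolated (G : groupType) (m : nat) (H : set G) : Prop :=
  forall g : G, H (g ^+ m) -> H g.

Definition pi_isolated (G : groupType) (pi : set nat) (H : set G) : Prop :=
  forall m : nat, [pred p in pi].-nat m -> isolated m H.

Definition pi_isolator (G : groupType) (pi : set nat) (H : set G) : set G :=
  smallest (fun K : set G => is_subgroup K /\ pi_isolated pi K) H.

(* Main.v *)
(** The isolator [I] of [H] is finitely generated because the finitely many
    words generating [H] trace a finite subgraph of the Schreier graph of [I]
    in [F].  The elements of [I] whose reduced word stays in that subgraph form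
    a subgroup [L] containing [H], and [L] is closed under roots lying in [I]:
    if [g = u c u^-1] with [c] cyclically reduced, then [u c^m u^-1] is reduced
    for [m > 0], so the path of [g ^ m] contains the path of [u c]; as [g] lies
    in [I], the final segment [u^-1] retraces the initial segment [u].  Hence
    [L] is pi-isolated, so [I = L] by minimality, and [L] is generated by the
    finitely many elements of [I] obtained by closing up the edges of the
    subgraph. *)
From HB Require Import structures.
Require Import Defs.
From mathcomp Require Import all_boot.
From mathcomp Require Import classical_sets cardinality.

Local Open Scope classical_set_scope.
Local Open Scope group_scope.

(** * Reduced words and free reduction *)

Section Words.
Context {X : eqType}.
Implicit Types (a b : X * bool) (w u v c : seq (X * bool)).

(* A letter is [(x, false)] for [x] and [(x, true)] for [x^-1]. *)
Definition linv a := (a.1, ~~ a.2).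
Definition winv w := rev (map linv w).
Definition noncancel a b := b != linv a.
Definition reduced w := sorted noncancel w.

(** Left multiplication by a letter, as in van der Waerden's trick: on reduced words [push a] is a
    bijection with inverse [push (linv a)]. *)
Definition push a w :=
  if w is b :: w' then if b == linv a then w' else a :: w else [:: a].
Definition reduce w := foldr push [::] w.

Lemma linvK : involutive linv.
Proof. by case=> x e; rewrite /linv /= negbK. Qed.

Lemma winv_cons a w : winv (a :: w) = winv w ++ [:: linv a].
Proof. by rewrite /winv /= rev_cons cats1. Qed.

Lemma winvK : involutive winv.
Proof. by move=> w; rewrite /winv map_rev revK (mapK linvK). Qed.

Lemma reduced_winv w : reduced w -> reduced (winv w).
Proof.
rewrite /reduced /winv rev_sorted sorted_map => rw.
apply: sub_sorted rw => a b /=; apply: contra_neq.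
by rewrite linvK => <-.
Qed.

Lemma reduced_push a w : reduced w -> reduced (push a w).
Proof.
case: w => [|b w] //= rw; case: eqP => [_|/eqP ba].
  exact: path_sorted rw.
by rewrite /= /noncancel ba.
Qed.

Lemma push_linvK a w : reduced w -> push (linv a) (push a w) = w.
Proof.
case: w => [|b w] /=; first by rewrite linvK eqxx.
case: eqP => [->|/eqP ba] /=; last by rewrite linvK eqxx.
by case: w => [|c w] //= /andP[/negPf]; rewrite /noncancel => ->.
Qed.

Lemma reduced_foldr_push v w : reduced v -> reduced (foldr push v w).
Proof. by move=> rv; elim: w => //= a w; apply: reduced_push. Qed.

Lemma reduced_reduce w : reduced (reduce w).
Proof. exact: reduced_foldr_push. Qed.

Lemma reduce_id w : reduced w -> reduce w = w.
Proof.
elim: w => //= a w IHw raw; rewrite IHw; last exact: path_sorted raw.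
by case: w raw {IHw} => //= b w /andP[/negPf->].
Qed.

(** If [a] cancels the head of [w], that head is [linv a], and pushing it is undone by pushing [a].
    Hence [foldr push v] factors through [reduce], the source of associativity. *)
Lemma foldr_push_push v a w : reduced v ->
  foldr push v (push a w) = push a (foldr push v w).
Proof.
case: w => [|b w] //= rv; case: eqP => // ->.
by rewrite -{1}(linvK a) push_linvK // reduced_foldr_push.
Qed.

Lemma foldr_push_reduce v w : reduced v ->
  foldr push v (reduce w) = foldr push v w.
Proof. by move=> rv; elim: w => //= a w IHw; rewrite foldr_push_push ?IHw. Qed.

Lemma reduce_cat u v : reduce (u ++ v) = foldr push (reduce v) u.
Proof. by rewrite /reduce foldr_cat. Qed.

Lemma reduce_catl u v : reduce (reduce u ++ v) = reduce (u ++ v).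
Proof. by rewrite !reduce_cat foldr_push_reduce // reduced_reduce. Qed.

Lemma reduce_catr u v : reduce (u ++ reduce v) = reduce (u ++ v).
Proof. by rewrite !reduce_cat (reduce_id _ (reduced_reduce _)). Qed.

Lemma reduce_winvK u v : reduce (winv u ++ u ++ v) = reduce v.
Proof.
elim: u => //= a u IHu; rewrite winv_cons -catA /=.
rewrite -IHu !(reduce_cat (winv u)); congr foldr => /=.
by rewrite push_linvK // reduced_reduce.
Qed.

Lemma reduce_winvl u : reduce (winv u ++ u) = [::].
Proof. by have := reduce_winvK u [::]; rewrite cats0. Qed.

Lemma reduce_winvr u : reduce (u ++ winv u) = [::].
Proof. by have := reduce_winvl (winv u); rewrite winvK. Qed.

Lemma reduced_catl u v : reduced (u ++ v) -> reduced u.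
Proof. by case: u => //= a u; rewrite cat_path => /andP[]. Qed.

(** Peel off the first and last letters while they are mutually inverse. The core stays nonempty: a
    letter is not its own inverse, and an empty middle would leave two adjacent cancelling
    letters. *)
Lemma reduced_conj_cycle w : reduced w -> w != [::] ->
  exists u c, [/\ w = u ++ c ++ winv u, c != [::] & cycle noncancel c].
Proof.
have [n] := ubnP (size w); elim: n w => // n IHn [//|a w] /= ltwn raw _.
have [ca|] := boolP (noncancel (last a w) a).
  by exists [::], (a :: w); rewrite cats0 /= rcons_path raw ca.
rewrite negbK => /eqP a_last.
case/lastP: w => [|w b] in raw ltwn a_last *.
  by move: a_last => /(congr1 snd) /=; case: (a.2).
move: a_last; rewrite last_rcons => /(congr1 linv); rewrite linvK => ba.
have rw : reduced w.
  by move: raw; rewrite -cats1 => /path_sorted /reduced_catl.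
have w0 : w != [::].
  by case: w raw {rw ltwn} => //=; rewrite /noncancel ba eqxx.
have [|u [c [wE c0 cc]]] := IHn w _ rw w0.
  by move: ltwn; rewrite size_rcons => /ltnW.
exists (a :: u), c; split=> //.
by rewrite winv_cons -ba wE -cats1 /= -!catA.
Qed.

Definition wpow c n := flatten (nseq n c).

(** The only new junction runs from the end of [c] to its start, and the cyclic condition covers
    it. *)
Lemma reduced_cat_cycle u c v : c != [::] -> cycle noncancel c ->
  reduced (u ++ c ++ v) -> reduced (u ++ c ++ c ++ v).
Proof.
case: c => // x c _; rewrite /= rcons_path => /andP[pc lx].
have cxc : path noncancel x (c ++ v) -> path noncancel x (c ++ x :: c ++ v).
  rewrite cat_path => /andP[_ lv].
  by rewrite !(cat_path, pc, lx) /= lx cat_path pc.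
case: u => [|y u] //=; rewrite !cat_path /= => /and3P[-> ->].
exact: cxc.
Qed.

Lemma reduced_conj_wpow u c v n : c != [::] -> cycle noncancel c ->
  reduced (u ++ c ++ v) -> reduced (u ++ c ++ wpow c n ++ v).
Proof.
move=> c0 cc rw; elim: n => //= n IHn; rewrite /wpow /= -catA.
exact: reduced_cat_cycle.
Qed.

End Words.

(** * The group of reduced words *)

Section FreeWordGroup.
Variable X : choiceType.

Definition freeword := {w : seq (X * bool) | reduced w}.
HB.instance Definition _ := Choice.on freeword.

Let fw_red w : freeword := exist _ (reduce w) (reduced_reduce w).
Definition fw_one : freeword := exist _ [::] isT.
Definition fw_mul (u v : freeword) : freeword := fw_red (val u ++ val v).
Definition fw_inv (u : freeword) : freeword :=
  exist _ (winv (val u)) (reduced_winv (val u) (valP u)).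

Lemma fw_mulA : associative fw_mul.
Proof.
by move=> u v w; apply: val_inj; rewrite /= reduce_catl reduce_catr catA.
Qed.

Lemma fw_mul1 : left_id fw_one fw_mul.
Proof. by move=> u; apply: val_inj; rewrite /= reduce_id //; case: u. Qed.

Lemma fw_mulr1 : right_id fw_one fw_mul.
Proof. by move=> u; apply: val_inj; rewrite /= cats0 reduce_id //; case: u. Qed.

Lemma fw_mulV : left_inverse fw_one fw_inv fw_mul.
Proof. by move=> u; apply: val_inj; rewrite /= reduce_winvl. Qed.

Lemma fw_mulrV : right_inverse fw_one fw_inv fw_mul.
Proof. by move=> u; apply: val_inj; rewrite /= reduce_winvr. Qed.

HB.instance Definition _ :=
  isGroup.Build freeword fw_mulA fw_mul1 fw_mulr1 fw_mulV fw_mulrV.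

End FreeWordGroup.

(** * Evaluation of words and normal forms *)

Section Evaluation.
Context {G : groupType}.
Implicit Types (a : G * bool) (w u v : seq (G * bool)).

Definition leval a : G := if a.2 then a.1^-1 else a.1.
Definition weval w : G := foldr (fun a g => leval a * g) 1 w.

Lemma leval_linv a : leval (linv a) = (leval a)^-1.
Proof. by case: a => x []; rewrite /leval /= ?invgK. Qed.

Lemma weval_cat u v : weval (u ++ v) = weval u * weval v.
Proof. by elim: u => [|a u /= ->]; rewrite ?mul1g ?mulgA. Qed.

Lemma weval_push a w : weval (push a w) = leval a * weval w.
Proof.
case: w => //= b w; case: eqP => //= ->.
by rewrite leval_linv mulVKg.
Qed.

Lemma weval_reduce w : weval (reduce w) = weval w.
Proof. by elim: w => //= a w IHw; rewrite weval_push IHw. Qed.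

Lemma weval_winv w : weval (winv w) = (weval w)^-1.
Proof.
elim: w => [|a w IHw]; first by rewrite invg1.
by rewrite winv_cons weval_cat IHw /= mulg1 leval_linv invgM.
Qed.

End Evaluation.

Definition freeword_eval (G : groupType) (w : freeword G) : G := weval (val w).

Lemma freeword_evalM (G : groupType) :
  {morph @freeword_eval G : u v / u * v}.
Proof. by move=> u v; rewrite /freeword_eval /= weval_reduce weval_cat. Qed.

HB.instance Definition _ (G : groupType) :=
  isMultiplicative.Build (freeword G) G (@freeword_eval G) (@freeword_evalM G).

(* Taking all of [F], not only a basis, as the alphabet suffices: the universal
   property makes [F] a retract of the group of reduced words on [F]. *)
Lemma free_normal_form (F : groupType) : is_free_group F ->
  exists nf : UMagmaMorphism.type F (freeword F), cancel nf (@freeword_eval F).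
Proof.
case=> B freeB.
have [nf [nfB _]] := freeB (freeword F) (fun x => exist _ [:: (x, false)] isT).
(* The identity and evaluation after [nf] agree on [B], so uniqueness with target [F] makes them
   equal. *)
have [phi [_ phiU]] := freeB F id.
have nf1 : nf 1 = 1.
  by apply: (@mulgI _ (nf 1)); rewrite -gmulfM !mulg1.
pose nf_morph := HB.pack_for (UMagmaMorphism.type F (freeword F))
  (nf : F -> freeword F)
  (isUMagmaMorphism.Build F (freeword F) nf (nf1, @gmulfM _ _ nf)).
exists nf_morph => x.
have idB y : B y -> (idfun : {multiplicative F -> F}) y = y by [].
have nfK y : B y ->
    (@freeword_eval F \o nf : {multiplicative F -> F}) y = y.
  by move=> By; rewrite /= nfB // /freeword_eval /= mulg1.
by rewrite [LHS](phiU _ nfK x) -(phiU _ idB x).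
Qed.

(** * Subgroups and isolators *)

Section Subgroups.
Context {G : groupType} {K : set G} (K_grp : is_subgroup K).

Lemma subgroup1 : K 1.
Proof. by have [/set_mem] := K_grp. Qed.

Lemma subgroup_div x y : K x -> K y -> K (x / y).
Proof. by move=> /mem_set Kx /mem_set Ky; apply/set_mem/(K_grp.2). Qed.

Lemma subgroupV x : K x -> K x^-1.
Proof. by move=> Kx; rewrite -div1g; apply: subgroup_div (subgroup1) Kx. Qed.

Lemma subgroupM x y : K x -> K y -> K (x * y).
Proof. by move=> Kx Ky; rewrite -[y]invgK; apply/subgroup_div/subgroupV. Qed.

End Subgroups.

Lemma is_subgroupP (G : groupType) (K : set G) :
  K 1 -> (forall x y, K x -> K y -> K (x / y)) -> is_subgroup K.
Proof.
move=> K1 Kdiv; split; first exact/mem_set.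
by move=> x y /set_mem Kx /set_mem Ky; apply/mem_set/Kdiv.
Qed.

Lemma is_subgroup_smallest (G : groupType) (C : set G -> Prop) (S : set G) :
  (forall K, C K -> is_subgroup K) -> is_subgroup (smallest C S).
Proof.
move=> Cgrp; apply: is_subgroupP => [|x y Sx Sy] K CSK.
  exact: subgroup1 (Cgrp _ CSK.1).
exact: subgroup_div (Cgrp _ CSK.1) _ _ (Sx _ CSK) (Sy _ CSK).
Qed.

Lemma pi_isolated_pi_isolator (G : groupType) (pi : set nat) (H : set G) :
  pi_isolated pi (pi_isolator pi H).
Proof.
move=> m pi_m g Igm K KH; have [[_ isoK] _] := KH.
exact: isoK (Igm _ KH).
Qed.

(** * Paths confined to a subgraph *)

Section StayingPaths.
Context {G : groupType} (U : set G) (A : {pred G * bool}).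
Hypothesis A_linv : forall a, a \in A -> linv a \in A.
Implicit Types (x : G) (w u v : seq (G * bool)).

(** The path is read in the Cayley graph; when [U] is a union of cosets [K x], it is a lift of a
    path in the Schreier graph of [K]. *)
Fixpoint stays x w : Prop :=
  if w is a :: w' then [/\ U x, a \in A & stays (x * leval a) w'] else U x.

Lemma stays_start {x w} : stays x w -> U x.
Proof. by case: w => [|a w] // []. Qed.

Lemma stays_cat x u v :
  stays x (u ++ v) <-> stays x u /\ stays (x * weval u) v.
Proof.
elim: u x => [|a u IHu] x /=.
  by rewrite mulg1; split=> [s|[]//]; split; first exact: stays_start s.
rewrite mulgA; split=> [[Ux aA /IHu[]]|[[Ux aA su] sv]]; split=> //.
exact/IHu.
Qed.

Lemma stays_push x a w :
  U x -> a \in A -> stays (x * leval a) w -> stays x (push a w).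
Proof.
case: w => [|b w] Ux aA //=; case: eqP => [->|_] // [_ _].
by rewrite leval_linv mulgK.
Qed.

(** Each cancellation deletes a backtrack, so no new vertex is visited. *)
Lemma stays_reduce x w : stays x w -> stays x (reduce w).
Proof.
by elim: w x => //= a w IHw x [Ux aA /IHw]; apply: stays_push.
Qed.

Lemma stays_winv x w : stays x w -> stays (x * weval w) (winv w).
Proof.
elim: w x => [|a w IHw] x /=; first by rewrite mulg1.
move=> [Ux aA sw]; rewrite winv_cons mulgA; apply/stays_cat; split.
  exact: IHw.
rewrite weval_winv mulgK /= leval_linv mulgK; split=> //.
  exact: stays_start sw.
exact: A_linv.
Qed.

Lemma stays_translate k x w :
  (forall y, U y -> U (k * y)) -> stays x w -> stays (k * x) w.
Proof.
move=> Uk; elim: w x => [|a w IHw] x /=; first exact: Uk.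
by case=> /Uk Ukx aA /IHw; rewrite mulgA.
Qed.

End StayingPaths.

Lemma val_expn_conj (X : choiceType) (w : freeword X) u c n :
  val w = u ++ c ++ winv u ->
  val (w ^+ n) = reduce (u ++ wpow c n ++ winv u).
Proof.
move=> wE; elim: n => [|n IHn].
  by rewrite expg0 /= reduce_winvr.
rewrite expgS /= IHn wE reduce_catr /wpow /=.
by rewrite -!catA !(reduce_cat u) !(reduce_cat c) reduce_winvK.
Qed.

(** * The staying subgroup, its roots and its generators *)

Section StayingSubgroup.
Context {F : groupType} (nf : UMagmaMorphism.type F (freeword F)).
Hypothesis nfK : cancel nf (@freeword_eval F).
Context {K : set F} (K_grp : is_subgroup K) (V : seq F) (A : seq (F * bool)).
Hypotheses (V1 : 1 \in V) (A_linv : forall a, a \in A -> linv a \in A).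

(* [x] represents a vertex [K x] of the Schreier graph. *)
Definition coset_vertex : set F := fun x => exists2 v, v \in V & K (x / v).
Definition staying : set F :=
  fun g => K g /\ stays coset_vertex [in A] 1 (val (nf g)).

Lemma coset_vertexM k x : K k -> coset_vertex x -> coset_vertex (k * x).
Proof.
move=> Kk [v vV Kxv]; exists v => //; rewrite -mulgA.
exact: subgroupM.
Qed.

Let weval_nf g : weval (val (nf g)) = g.
Proof. exact: nfK. Qed.

Lemma is_subgroup_staying : is_subgroup staying.
Proof.
have U1 : coset_vertex 1 by exists 1 => //; rewrite mulgV; apply: subgroup1.
have stay_loop k w : K k -> stays coset_vertex [in A] 1 w ->
    stays coset_vertex [in A] k w.
  move=> Kk sw; rewrite -[k]mulg1; apply: stays_translate sw => y.
  exact: coset_vertexM.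
apply: is_subgroupP.
  split; first exact: subgroup1.
  by rewrite gmulf1.
move=> x y [Kx sx] [Ky sy]; have Kyv := subgroupV K_grp y Ky.
split; first exact: subgroup_div.
rewrite gmulfM gmulfV /=; apply: stays_reduce; apply/stays_cat; split=> //.
rewrite mul1g weval_nf; apply: (stay_loop _ _ Kx).
(* The path of [y^-1] from 1 is the reversed path of [y], translated by [y^-1], an element of
   [K]. *)
rewrite -(mulVg y) -{2}(weval_nf y) -[y^-1]mulg1 -mulgA; apply: stays_translate.
  by move=> z; apply: coset_vertexM.
exact: stays_winv.
Qed.

Lemma staying_root g m : 0 < m -> K g -> staying (g ^+ m) -> staying g.
Proof.
case: m => // m _ Kg [_ sgm]; split=> //.
have [w0|w0] := eqVneq (val (nf g)) [::].
  by rewrite w0; exact: stays_start sgm.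
have [u [c [wE c0 cc]]] := reduced_conj_cycle _ (valP (nf g)) w0.
have rw : reduced (u ++ c ++ winv u) by rewrite -wE (valP (nf g)).
move: sgm; rewrite gmulfXn (val_expn_conj _ _ _ _ m.+1 wE) /wpow /= -catA.
rewrite reduce_id; last exact: reduced_conj_wpow.
move=> /stays_cat[su /stays_cat[sc _]]; rewrite wE.
apply/stays_cat; split=> //; apply/stays_cat; split=> //.
(* The end of [u ++ c] is the translate by [g] of the end of [u], so the last segment is the
   reversed path of [u], translated by [g]. *)
have -> : 1 * weval u * weval c = g * (1 * weval u).
  rewrite !mul1g -[in RHS](weval_nf g) wE !weval_cat weval_winv.
  by rewrite -!mulgA mulVg mulg1.
apply: stays_translate; first by move=> y; apply: coset_vertexM.
exact: stays_winv.
Qed.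

(** Schreier generators, one for each edge [a] from [K v] to [K z]. Distinct elements of [V] may
    represent one coset, so those lying in [K] are added. *)
Definition closed_edges : set F :=
  K `&` [set` V ++
              [seq q.1 * leval a / q.2 | q <- [seq (v, z) | v <- V, z <- V],
                                         a <- A]].

Lemma closed_edge v a z :
  v \in V -> a \in A -> z \in V -> K (v * leval a / z) ->
  closed_edges (v * leval a / z).
Proof.
move=> vV aA zV Ke; split=> //=; rewrite mem_cat; apply/orP; right.
apply/allpairsP; exists ((v, z), a); split=> //=.
by apply/allpairsP; exists (v, z).
Qed.

(** Replacing each vertex of the path by a representative in [V] makes the product telescope into
    one closed edge per letter. *)
Lemma stays_generated x w v : v \in V -> K (x / v) ->
  stays coset_vertex [in A] x w ->
  exists z, [/\ z \in V, K (x * weval w / z)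
              & generated closed_edges (v * weval w / z)].
Proof.
have genS : is_subgroup (generated closed_edges).
  exact: is_subgroup_smallest.
elim: w x v => [|a w IHw] x v vV Kxv /=.
  move=> _; exists v; rewrite !mulg1 mulgV; split=> //.
  exact: subgroup1.
move=> [Ux aA sw]; have [y yV Kxay] := stays_start _ _ sw.
have [z [zV Kz genz]] := IHw _ _ yV Kxay sw.
exists z; split=> //; first by rewrite mulgA.
have -> : v * (leval a * weval w) / z =
    v * leval a / y * (y * weval w / z) by rewrite -!mulgA mulKg.
apply: (subgroupM genS) genz; apply: sub_gen_smallest.
apply: closed_edge => //.
have -> : v * leval a / y = (x / v)^-1 * (x * leval a / y).
  by rewrite invgM invgK -!mulgA mulKg.
by apply: (subgroupM K_grp) Kxay; apply: (subgroupV K_grp).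
Qed.

Lemma staying_generated : staying `<=` generated closed_edges.
Proof.
have genS : is_subgroup (generated closed_edges).
  exact: is_subgroup_smallest.
move=> g [Kg sg].
have K11 : K (1 / 1) by rewrite mulgV; apply: subgroup1.
have [z [zV Kgz genz]] := stays_generated _ _ _ V1 K11 sg.
move: Kgz genz; rewrite !mul1g weval_nf => Kgz genz.
(* As [g] lies in [K], so does the final representative [z]; it is then itself a generator, and
   [g = (g / z) * z]. *)
have Kz : K z.
  rewrite -[z]invgK -[z^-1](mulKg g).
  by apply/subgroupV/subgroupM => //; apply: subgroupV.
rewrite -(mulgVK z g); apply: (subgroupM genS) => //.
by apply: sub_gen_smallest; split=> //=; rewrite mem_cat zV.
Qed.

End StayingSubgroup.

(** * Finite generation of the isolator *)

Lemma stays_prefixes (G : groupType) (U : set G) (A : {pred G * bool}) x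
    (w : seq (G * bool)) :
  (forall i, U (x * weval (take i w))) -> {subset w <= A} -> stays U A x w.
Proof.
elim: w x => [|a w IHw] x Uw wA /=; first by rewrite -[x]mulg1; apply: (Uw 0).
split; first by rewrite -[x]mulg1; apply: (Uw 0).
  by apply: wA; rewrite mem_head.
apply: IHw => [i|b bw]; first by rewrite -mulgA; apply: (Uw i.+1).
by apply: wA; rewrite inE bw orbT.
Qed.

Theorem mainTheorem1 (F : groupType) (F_free : is_free_group F)
    (pi : set nat) (pi_prime : forall p : nat, pi p -> prime p)
    (pi_neq0 : pi !=set0)
    (H : set F) (H_fg : fg_subgroup H) :
  fg_subgroup (pi_isolator pi H).
Proof.
have [nf nfK] := free_normal_form _ F_free.
have [_ [S /finite_seqP[s ->] HE]] := H_fg; pose I := pi_isolator pi H.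
have I_grp : is_subgroup I by apply: is_subgroup_smallest => K [].
pose W := [seq val (nf x) | x <- s].
pose A := flatten W ++ map linv (flatten W).
pose prefixes (w : seq (F * bool)) :=
  [seq weval (take i w) | i <- iota 0 (size w).+1].
pose V : seq F := 1 :: flatten (map prefixes W).
have V1 : 1 \in V by rewrite mem_head.
have A_linv a : a \in A -> linv a \in A.
  rewrite !mem_cat => /orP[aW|/mapP[b bW ->]]; last by rewrite linvK bW.
  by rewrite map_f ?orbT.
pose L := @staying F nf I V A.
have L_grp : is_subgroup L by apply: is_subgroup_staying.
have sL : [set` s] `<=` L.
  move=> x /= xs; have wW : val (nf x) \in W by apply: map_f.
  split.
    by move=> K [_]; apply; rewrite HE; apply: sub_gen_smallest.
  apply: stays_prefixes => [i|a aw]; last first.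
    rewrite -[a \in _]/(a \in A) mem_cat; apply/orP; left.
    by apply/flattenP; exists (val (nf x)).
  rewrite mul1g; exists (weval (take i (val (nf x)))); last first.
    by rewrite mulgV; apply: subgroup1.
  rewrite inE; apply/orP; right; apply/flattenP.
  exists (prefixes (val (nf x))); first exact: map_f.
  (* Beyond the length of the word, [take i] returns the whole word, which [prefixes] lists last. *)
  apply/mapP; exists (minn i (size (val (nf x)))).
    by rewrite mem_iota /= add0n ltnS geq_minr.
  by rewrite take_min take_size.
have HL : H `<=` L by rewrite HE; apply: smallest_sub.
(* Isolation of [I] puts the root [g] in [I], as [staying_root] requires. *)
have L_iso : pi_isolated pi L.
  move=> m pi_m g [Igm Lgm].
  apply: (@staying_root F nf nfK I I_grp V A A_linv g m) => //.
    by case/andP: pi_m.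
  exact: pi_isolated_pi_isolator pi_m _ Igm.
have IL : I `<=` L by apply: smallest_sub.
split=> //; exists (@closed_edges F I V A).
  exact/finite_setIr/finite_seq.
apply/seteqP; split.
  by apply: subset_trans IL _; apply: staying_generated.
by apply: smallest_sub => // x [].
Qed.
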